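(* Let $\gamma$ be a centroaffine $\pi$-anti-periodic curve with centroaffine curvature $p$, and let $\lambda_0<0$ be the lowest $\pi$-periodic eigenvalue of the associated Hill equation $y''+(\lambda-p(t))y=0$. Let $c\in\mathbb{R}$. Then $\gamma$ admits a $c$-related closed ($\pi$-anti-periodic) centroaffine curve if and only if $|c|\le 1/\sqrt{-\lambda_0}$.
   Context: For $u,v\in\mathbb{R}^2$, $[u,v]$ denotes the determinant of the matrix with columns $u,v$. A centroaffine curve is a smooth curve $\gamma:\mathbb{R}\to\mathbb{R}^2$ with $[\gamma(t),\gamma'(t)]=1$ for all $t$; it is $\pi$-anti-periodic if $\gamma(t+\pi)=-\gamma(t)$ for all $t$. Its centroaffine curvature is the $\pi$-periodic function $p$ with $\gamma''=p\gamma$. Centroaffine curves $\gamma,\delta$ are $c$-related if $[\gamma(t),\delta(t)]=c$ for all $t$. The $\pi$-periodic eigenvalues of the Hill equation are the real $\lambda$ for which $y''+(\lambda-p)y=0$ has a non-trivial real $\pi$-periodic solution; they form a sequence bounded below, with smallest element $\lambda_0$, and whenever $p$ is the centroaffine curvature of a $\pi$-anti-periodic centroaffine curve $\gamma$, $\lambda_0$ is always negative. *)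

(* Defs.v *)
(* Stdlib reals with Coquelicot. *)
From Stdlib Require Import Reals.
From Coquelicot Require Import Coquelicot.
Open Scope R_scope.

(** [det2 u v] is the determinant of the matrix with columns [u], [v]. *)
Definition det2 (u v : R * R) : R := fst u * snd v - snd u * fst v.

Definition smooth_curve (g : R -> R * R) : Prop :=
  forall (n : nat) (t : R),
    ex_derive_n (fun s => fst (g s)) n t /\ ex_derive_n (fun s => snd (g s)) n t.

(** [Derive] is only available for real-valued functions, so curves are
    differentiated coordinatewise; the value is meaningful on smooth curves. *)
Definition velocity (g : R -> R * R) (t : R) : R * R :=
  (Derive (fun s => fst (g s)) t, Derive (fun s => snd (g s)) t).

Definition centroaffine (g : R -> R * R) : Prop :=
  smooth_curve g /\ forall t : R, det2 (g t) (velocity g t) = 1.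

Definition anti_periodic (g : R -> R * R) : Prop :=
  forall t : R, g (t + PI) = opp (g t).

(** As a centroaffine curve never vanishes, this determines [p]; when the curve
    is anti-periodic, [p] is automatically [PI]-periodic. *)
Definition centroaffine_curvature (g : R -> R * R) (p : R -> R) : Prop :=
  forall t : R, velocity (velocity g) t = scal (p t) (g t).

Definition c_related (c : R) (g d : R -> R * R) : Prop :=
  forall t : R, det2 (g t) (d t) = c.

(** Differentiability is required explicitly because [Derive] is total. *)
Definition hill_solution (p : R -> R) (lam : R) (y : R -> R) : Prop :=
  forall t : R,
    ex_derive y t /\ ex_derive (Derive y) t /\
    Derive (Derive y) t + (lam - p t) * y t = 0.

Definition periodic_eigenvalue (p : R -> R) (lam : R) : Prop :=
  exists y : R -> R,
    hill_solution p lam y /\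
    (forall t : R, y (t + PI) = y t) /\
    (exists t : R, y t <> 0).

Definition lowest_periodic_eigenvalue (p : R -> R) (lam0 : R) : Prop :=
  periodic_eigenvalue p lam0 /\
  forall lam : R, periodic_eigenvalue p lam -> lam0 <= lam.

(* Main.v *)
Require Import Defs.
From Stdlib Require Import Reals Lra Lia ZArith ClassicalEpsilon.
From Coquelicot Require Import Coquelicot.
Open Scope R_scope.

(** Since [det2 gamma gamma' = 1], a curve [c]-related to [gamma] has the form
    [delta = a gamma + c gamma'].  For [c <> 0], put [w = - a / c]; using
    [gamma'' = p gamma], the condition [det2 delta delta' = 1] becomes the
    Riccati equation [w' + w^2 = p - lam] with [lam = - 1 / c^2], and [delta] is
    anti-periodic exactly when [w] is periodic.  So the theorem says that the
    Riccati equation has a periodic solution if and only if [lam <= lam0].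

    Suppose that [w] is such a solution and that [y] is a periodic
    eigenfunction for [mu].  Then [F = y y' - w y^2] is periodic and
    [F' = (y' - w y)^2 + (lam - mu) y^2], which forces [lam <= mu]
    ([riccati_solution_le_eigenvalue]).

    For the converse, let [S] be the set of [lam] for which a periodic solution
    exists.  It is closed downwards, because a periodic subsolution
    ([v' + v^2 <= p - lam]) lies below a periodic solution, in fact below a
    largest one ([riccati_maximal_solution]); and it contains every lower bound
    of [p], where the zero function is a subsolution.  It is bounded above by
    every periodic eigenvalue, by the first part, and it contains its supremum
    [top] ([riccati_solution_left_closed]).  Let [w] be a solution at [top].  If
    the mean of [w] were not zero, then the linearised equation [h' + 2 w h = -1]
    would have a periodic solution [h], and [w + e h] would for small [e > 0] be
    a subsolution at a parameter larger than [top]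
    ([riccati_subsolution_beyond]).  So the mean is zero, the exponential of a
    primitive of [w] is a positive periodic eigenfunction for [top], and
    [lam0 <= top].

    All periodic functions that are needed arise from first-order linear
    equations, whose periodic solutions are explicit, and from monotone limits
    ([linear_comparison], [is_derive_limit]). *)

(** * Calculus on the line *)

Lemma nondecreasing_of_derive_nonneg (f df : R -> R) :
  (forall t, is_derive f t (df t)) -> (forall t, 0 <= df t) ->
  forall s t, s <= t -> f s <= f t.
Proof.
  intros Hf Hd s t Hst.
  destruct (MVT_gen f s t df) as [x [_ Hx]].
  - intros; apply Hf.
  - intros x _; apply derivable_continuous_pt.
    exists (df x); apply is_derive_Reals, Hf.
  - specialize (Hd x); nra.
Qed.

Lemma lipschitz_of_derive_bounded (f df : R -> R) (C : R) :
  (forall t, is_derive f t (df t)) -> (forall t, Rabs (df t) <= C) ->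
  forall s t, Rabs (f t - f s) <= C * Rabs (t - s).
Proof.
  intros Hf Hd s t.
  destruct (MVT_gen f s t df) as [x [_ Hx]].
  - intros; apply Hf.
  - intros x _; apply derivable_continuous_pt.
    exists (df x); apply is_derive_Reals, Hf.
  - rewrite Hx, Rabs_mult.
    apply Rmult_le_compat_r; [apply Rabs_pos | apply Hd].
Qed.

Lemma constant_of_derive_zero (f : R -> R) :
  (forall t, is_derive f t 0) -> forall s t, f t = f s.
Proof.
  intros Hf s t.
  pose proof (lipschitz_of_derive_bounded f (fun _ => 0) 0 Hf) as H.
  assert (H0 : Rabs (f t - f s) <= 0 * Rabs (t - s)).
  { apply H; intros _; rewrite Rabs_R0; lra. }
  rewrite Rmult_0_l in H0.
  pose proof (Rabs_pos (f t - f s)).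
  apply Rminus_diag_uniq.
  destruct (Req_dec (f t - f s) 0) as [E | E]; [exact E|].
  apply Rabs_pos_lt in E; lra.
Qed.

Lemma is_derive_value (f : R -> R) (t l l' : R) :
  is_derive f t l -> l = l' -> is_derive f t l'.
Proof. now intros H <-. Qed.

Lemma continuous_of_is_derive (f : R -> R) (t l : R) :
  is_derive f t l -> continuous f t.
Proof. intros H; apply (ex_derive_continuous f t); now exists l. Qed.

Lemma is_derive_primitive (f : R -> R) (a t : R) :
  (forall s, continuous f s) -> is_derive (RInt f a) t (f t).
Proof.
  intros Hf; apply is_derive_RInt with (a := a); [|apply Hf].
  exists (mkposreal 1 Rlt_0_1); intros s _.
  apply (RInt_correct f a s), ex_RInt_continuous; intros; apply Hf.
Qed.

Lemma is_derive_mul (f g : R -> R) (t df dg : R) :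
  is_derive f t df -> is_derive g t dg ->
  is_derive (fun s => f s * g s) t (df * g t + f t * dg).
Proof. intros Hf Hg; apply (is_derive_mult f g t df dg Hf Hg Rmult_comm). Qed.

Lemma is_derive_shift (f : R -> R) (T t l : R) :
  is_derive f (t + T) l -> is_derive (fun s => f (s + T)) t l.
Proof.
  intros H.
  evar_last.
  - apply (is_derive_comp f (fun s => s + T) t l 1); [exact H|].
    auto_derive; [exact I | ring].
  - unfold scal; simpl; unfold mult; simpl; ring.
Qed.

(** Pointwise convergence suffices because a common Lipschitz constant [C] of
    the derivatives makes the first-order Taylor remainders at most [C h^2],
    a bound that survives the limit. *)
Lemma is_derive_limit (f df : nat -> R -> R) (F G : R -> R) (C : R) :
  (forall n t, is_derive (f n) t (df n t)) ->
  (forall n s t, Rabs (df n t - df n s) <= C * Rabs (t - s)) ->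
  (forall t, is_lim_seq (fun n => f n t) (F t)) ->
  (forall t, is_lim_seq (fun n => df n t) (G t)) ->
  forall t, is_derive F t (G t).
Proof.
  intros Hf HC HF HG t.
  assert (HC0 : 0 <= C).
  { specialize (HC 0%nat 0 1); pose proof (Rabs_pos (df 0%nat 1 - df 0%nat 0)).
    rewrite Rminus_0_r, Rabs_R1 in HC; lra. }
  assert (Hn : forall n h,
    Rabs (f n (t + h) - f n t - h * df n t) <= C * Rabs h * Rabs h).
  { intros n h.
    destruct (MVT_gen (f n) t (t + h) (df n)) as [x [Hx Heq]].
    - intros; apply Hf.
    - intros x _; apply derivable_continuous_pt.
      exists (df n x); apply is_derive_Reals, Hf.
    - replace (f n (t + h) - f n t - h * df n t)
        with ((df n x - df n t) * h) by (rewrite Heq; ring).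
      rewrite Rabs_mult; apply Rmult_le_compat_r; [apply Rabs_pos|].
      eapply Rle_trans; [apply HC|].
      apply Rmult_le_compat_l; [exact HC0|].
      revert Hx; unfold Rmin, Rmax, Rabs.
      destruct (Rle_dec t (t + h)), (Rcase_abs (x - t)), (Rcase_abs h); lra. }
  assert (HL : forall h,
    Rabs (F (t + h) - F t - h * G t) <= C * Rabs h * Rabs h).
  { intros h.
    assert (L : is_lim_seq (fun n => Rabs (f n (t + h) - f n t - h * df n t))
                  (Rabs (F (t + h) - F t - h * G t))).
    { apply (is_lim_seq_abs _ (Finite _)).
      apply is_lim_seq_minus'; [apply is_lim_seq_minus'; apply HF|].
      apply (is_lim_seq_scal_l _ h (Finite _)), HG. }
    exact (is_lim_seq_le _ _ _ _ (fun n => Hn n h) L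
             (is_lim_seq_const (C * Rabs h * Rabs h))). }
  apply is_derive_Reals; intros eps Heps.
  assert (Hd : 0 < eps / (C + 1)) by (apply Rdiv_lt_0_compat; lra).
  exists (mkposreal _ Hd); simpl; intros h Hh Hlt.
  replace ((F (t + h) - F t) / h - G t)
    with ((F (t + h) - F t - h * G t) / h) by (field; exact Hh).
  pose proof (Rabs_pos_lt h Hh) as Hp.
  unfold Rdiv at 1; rewrite Rabs_mult, Rabs_inv.
  apply Rmult_lt_reg_r with (Rabs h); [exact Hp|].
  rewrite Rmult_assoc, Rinv_l, Rmult_1_r by lra.
  eapply Rle_lt_trans; [apply HL|].
  apply Rmult_lt_compat_r; [exact Hp|].
  apply (Rmult_lt_compat_r (C + 1)) in Hlt; [|lra].
  unfold Rdiv in Hlt; rewrite Rmult_assoc, Rinv_l, Rmult_1_r in Hlt by lra.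
  lra.
Qed.

(** * Periodic functions *)

Definition periodic (T : R) (f : R -> R) : Prop := forall t, f (t + T) = f t.

Lemma periodic_shift_int (T : R) (f : R -> R) (t : R) (n : Z) :
  periodic T f -> f (t + IZR n * T) = f t.
Proof.
  intros Hf.
  assert (Hnat : forall (k : nat) s, f (s + INR k * T) = f s).
  { induction k as [|k IH]; intros s.
    - f_equal; simpl; ring.
    - rewrite <- (IH s), <- (Hf (s + INR k * T)); f_equal; rewrite S_INR; ring. }
  destruct (Z.le_gt_cases 0 n) as [Hn | Hn].
  - rewrite <- (Z2Nat.id n Hn), <- INR_IZR_INZ; apply Hnat.
  - rewrite <- (Hnat (Z.to_nat (- n)) (t + IZR n * T)); f_equal.
    rewrite INR_IZR_INZ, Z2Nat.id, opp_IZR by lia; ring.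
Qed.

Lemma periodic_continuous_bounded (T : R) (f : R -> R) :
  0 < T -> periodic T f -> (forall t, continuous f t) ->
  exists M, 0 < M /\ forall t, Rabs (f t) <= M.
Proof.
  intros HT Hf Hc.
  destruct (bounded_continuity f 0 T (fun x _ => Hc x)) as [M HM].
  assert (HM0 : forall t, Rabs (f t) <= M).
  { intros t.
    destruct (floor_ex (t / T)) as [n [Hn1 Hn2]].
    rewrite <- (periodic_shift_int T f t (- n) Hf), opp_IZR.
    apply Rlt_le, HM.
    assert (E : t = t / T * T) by (field; lra).
    split; rewrite E; nra. }
  exists M; split; [|exact HM0].
  eapply Rle_lt_trans; [apply Rabs_pos | apply (HM 0); lra].
Qed.

Lemma periodic_derivative (T : R) (f df : R -> R) :
  periodic T f -> (forall t, is_derive f t (df t)) -> periodic T df.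
Proof.
  intros Hp Hd t.
  transitivity (Derive f t); [|apply is_derive_unique, Hd].
  symmetry; apply is_derive_unique.
  apply is_derive_ext with (fun s => f (s + T)); [intros; apply Hp|].
  apply is_derive_shift, Hd.
Qed.

(** On the interval from [t - T] to [t + T] a monotone function is squeezed
    between its values at the ends, which periodicity makes equal. *)
Lemma periodic_nondecreasing_derive_zero (T : R) (f df : R -> R) :
  0 < T -> periodic T f -> (forall t, is_derive f t (df t)) ->
  (forall t, 0 <= df t) -> forall t, df t = 0.
Proof.
  intros HT Hp Hd Hpos t.
  pose proof (nondecreasing_of_derive_nonneg f df Hd Hpos) as Hm.
  rewrite <- (is_derive_unique _ _ _ (Hd t)).
  apply is_derive_unique.
  apply is_derive_ext_loc with (fun _ => f t).
  - exists (mkposreal T HT); intros s Hs.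
    unfold ball in Hs; simpl in Hs; unfold AbsRing_ball, abs, minus, plus, opp in Hs.
    simpl in Hs; apply Rabs_def2 in Hs.
    assert (E : f (t - T) = f t).
    { rewrite <- (Hp (t - T)); f_equal; ring. }
    assert (f (t - T) <= f s) by (apply Hm; lra).
    assert (f s <= f (t + T)) by (apply Hm; lra).
    rewrite Hp in H0; lra.
  - apply (is_derive_const (f t) t).
Qed.

(** Multiplying [v - u] by the integrating factor [exp (k t)] gives a monotone
    function which one period multiplies by [exp (k T)], a factor different
    from 1; the sign of [v - u] follows.  The factor [k] in the hypothesis
    treats both signs of [k] at once: for [k < 0] it reverses the comparison of
    [u' + k u] with [v' + k v]. *)
Lemma linear_comparison (T k : R) (u v du dv : R -> R) :
  0 < T -> k <> 0 -> periodic T u -> periodic T v ->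
  (forall t, is_derive u t (du t)) -> (forall t, is_derive v t (dv t)) ->
  (forall t, k * (du t + k * u t) <= k * (dv t + k * v t)) ->
  forall t, u t <= v t.
Proof.
  intros HT Hk Pu Pv Hu Hv Hle t.
  set (d := fun s => v s - u s).
  assert (Hm : k * (exp (k * t) * d t) <= k * (exp (k * (t + T)) * d (t + T))).
  { apply (nondecreasing_of_derive_nonneg
      (fun s => k * (exp (k * s) * d s))
      (fun s => exp (k * s) * (k * (dv s + k * v s) - k * (du s + k * u s)))).
    - intros s; unfold d.
      pose proof (is_derive_unique _ _ _ (Hu s) : Derive (fun x : R => u x) s = du s) as Eu.
      pose proof (is_derive_unique _ _ _ (Hv s) : Derive (fun x : R => v x) s = dv s) as Ev.
      auto_derive.
      + split; [now exists (dv s) | split; [now exists (du s) | exact I]].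
      + rewrite Eu, Ev; ring.
    - intros s; specialize (Hle s).
      apply Rmult_le_pos; [apply Rlt_le, exp_pos | lra].
    - lra. }
  unfold d in Hm; rewrite Pu, Pv, Rmult_plus_distr_l, exp_plus in Hm.
  assert (Hf : 0 < k * (exp (k * T) - 1)).
  { destruct (Rdichotomy _ _ Hk) as [Hn | Hn].
    - assert (H : exp (k * T) < exp 0) by (apply exp_increasing; nra).
      rewrite exp_0 in H; nra.
    - assert (H : exp 0 < exp (k * T)) by (apply exp_increasing; nra).
      rewrite exp_0 in H; nra. }
  pose proof (exp_pos (k * t)) as He.
  assert (Hc : 0 < exp (k * t) * (k * (exp (k * T) - 1))) by (apply Rmult_lt_0_compat; lra).
  apply Rminus_le_0, (Rmult_le_reg_l _ _ _ Hc).
  nra.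
Qed.

(** Covers the primitive of a periodic function ([m = 1]) and that of a
    function which one period multiplies by a constant. *)
Lemma primitive_quasiperiodic (T m : R) (g : R -> R) :
  (forall t, continuous g t) -> (forall t, g (t + T) = m * g t) ->
  forall t, RInt g 0 (t + T) = RInt g 0 T + m * RInt g 0 t.
Proof.
  intros Hc Hg t.
  assert (H := constant_of_derive_zero
    (fun s => RInt g 0 (s + T) - m * RInt g 0 s)).
  assert (Hz : forall s, is_derive (fun s => RInt g 0 (s + T) - m * RInt g 0 s) s 0).
  { intros s.
    evar_last.
    - apply (is_derive_minus (V := R_NormedModule)).
      + apply is_derive_shift, is_derive_primitive, Hc.
      + apply is_derive_scal, is_derive_primitive, Hc.
    - rewrite Hg; unfold minus, plus, opp, scal; simpl; unfold mult; simpl; ring. }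
  specialize (H Hz 0 t); simpl in H.
  rewrite RInt_point, Rplus_0_l in H; unfold zero in H; simpl in H; lra.
Qed.

(** * Periodic solutions of first-order linear equations *)

Definition exp_primitive (a : R -> R) (t : R) : R := exp (RInt a 0 t).

Lemma is_derive_exp_primitive (a : R -> R) (t : R) :
  (forall s, continuous a s) ->
  is_derive (exp_primitive a) t (a t * exp_primitive a t).
Proof.
  intros Ha.
  apply (is_derive_comp exp (RInt a 0) t).
  - apply is_derive_exp.
  - now apply is_derive_primitive.
Qed.

Lemma exp_primitive_shift (T : R) (a : R -> R) (t : R) :
  (forall s, continuous a s) -> periodic T a ->
  exp_primitive a (t + T) = exp_primitive a T * exp_primitive a t.
Proof.
  intros Ha Hp; unfold exp_primitive.
  rewrite (primitive_quasiperiodic T 1 a Ha), Rmult_1_l, exp_plus; [ring|].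
  intros s; rewrite Hp; ring.
Qed.

(** Variation of constants for [x' + a x = f]; the constant of integration is
    the one that makes the values at [0] and [T] agree. *)
Definition linear_periodic_solution (T : R) (a f : R -> R) (t : R) : R :=
  let J := RInt (fun s => exp_primitive a s * f s) 0 in
  (J T / (exp_primitive a T - 1) + J t) / exp_primitive a t.

Lemma linear_periodic_solution_spec (T : R) (a f : R -> R) :
  (forall t, continuous a t) -> (forall t, continuous f t) ->
  periodic T a -> periodic T f -> RInt a 0 T <> 0 ->
  periodic T (linear_periodic_solution T a f) /\
  forall t, is_derive (linear_periodic_solution T a f) t
              (f t - a t * linear_periodic_solution T a f t).
Proof.
  intros Ha Hf Pa Pf HI.
  set (g := fun s => exp_primitive a s * f s).
  assert (Hg : forall t, continuous g t).
  { intros t; apply (continuous_mult (exp_primitive a) f); [|apply Hf].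
    eapply continuous_of_is_derive, is_derive_exp_primitive, Ha. }
  assert (Hpos : forall t, 0 < exp_primitive a t) by (intros; apply exp_pos).
  assert (H1 : exp_primitive a T - 1 <> 0).
  { unfold exp_primitive; intros E; apply HI, exp_inv; rewrite exp_0; lra. }
  unfold linear_periodic_solution; fold g; split.
  - intros t.
    rewrite (primitive_quasiperiodic T (exp_primitive a T) g Hg).
    + rewrite exp_primitive_shift by assumption.
      pose proof (Hpos t); pose proof (Hpos T).
      field; repeat split; lra.
    + intros s; unfold g; rewrite exp_primitive_shift, Pf by assumption; ring.
  - intros t.
    pose proof (Hpos t) as Ht.
    evar_last.
    + apply is_derive_div; [|apply is_derive_exp_primitive, Ha|lra].
      apply (is_derive_plus (V := R_NormedModule));
        [apply is_derive_const | apply is_derive_primitive, Hg].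
    + unfold plus, zero, g; simpl; field; split; [exact H1 | lra].
Qed.

(** * Periodic Riccati equations *)

Definition riccati_solution (T : R) (q w : R -> R) : Prop :=
  periodic T w /\ forall t, is_derive w t (q t - w t ^ 2).

Definition riccati_subsolution (T : R) (q v : R -> R) : Prop :=
  periodic T v /\
  exists dv, (forall t, is_derive v t (dv t)) /\
             forall t, dv t + v t ^ 2 <= q t.

Lemma riccati_solution_subsolution (T : R) (q q' w : R -> R) :
  riccati_solution T q w -> (forall t, q t <= q' t) ->
  riccati_subsolution T q' w.
Proof.
  intros [Hp Hw] Hq; split; [exact Hp|].
  exists (fun t => q t - w t ^ 2); split; [exact Hw|].
  intros t; specialize (Hq t); lra.
Qed.

(** A subsolution satisfies [v' + 2 K v <= K^2 + 2 K v - v^2], which is at most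
    [2 K^2] since [(v - K)^2 >= 0]; the constant [K] has [2 K^2] there. *)
Lemma riccati_subsolution_le (T K : R) (q v : R -> R) :
  0 < T -> 0 < K -> (forall t, q t <= K ^ 2) ->
  riccati_subsolution T q v -> forall t, v t <= K.
Proof.
  intros HT HK HqK [Hp [dv [Hd Hv]]].
  apply (linear_comparison T (2 * K) v (fun _ => K) dv (fun _ => 0)); auto.
  - lra.
  - intros s; reflexivity.
  - intros s; apply (is_derive_const (V := R_NormedModule)).
  - intros s; specialize (HqK s); specialize (Hv s).
    apply Rmult_le_compat_l; [lra|].
    pose proof (pow2_ge_0 (v s - K)); nra.
Qed.

(** The mirror image of the upper bound under time reversal, which turns [w]
    into [- w]; hence the comparison has the negative rate [- 2 K]. *)
Lemma riccati_solution_ge (T K : R) (q w : R -> R) :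
  0 < T -> 0 < K -> (forall t, q t <= K ^ 2) ->
  riccati_solution T q w -> forall t, - K <= w t.
Proof.
  intros HT HK HqK [Hp Hw].
  apply (linear_comparison T (- (2 * K)) (fun _ => - K) w (fun _ => 0)
           (fun s => q s - w s ^ 2)); auto.
  - lra.
  - intros s; reflexivity.
  - intros s; apply (is_derive_const (V := R_NormedModule)).
  - intros s; specialize (HqK s).
    apply Rmult_le_compat_neg_l; [lra|].
    pose proof (pow2_ge_0 (w s + K)); nra.
Qed.

(** The Riccati equation [x' = q - x^2] rewritten as
    [x' + 2 K x = q + 2 K x - x^2]: the right-hand side is now nondecreasing in
    [x] as long as [x <= K], so that solving the linear equation for the left
    side is an order-preserving map. *)
Definition riccati_forcing (K : R) (q x : R -> R) (t : R) : R :=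
  q t + 2 * K * x t - x t ^ 2.

Fixpoint riccati_iterate (T K : R) (q : R -> R) (n : nat) : R -> R :=
  match n with
  | O => fun _ => K
  | S m => linear_periodic_solution T (fun _ => 2 * K)
             (riccati_forcing K q (riccati_iterate T K q m))
  end.

Lemma riccati_forcing_le (K : R) (q x y : R -> R) (t : R) :
  x t <= y t -> y t <= K -> riccati_forcing K q x t <= riccati_forcing K q y t.
Proof. unfold riccati_forcing; intros; nra. Qed.

(** Continuity of the iterates, which makes the next one well defined, comes
    from their being differentiable; hence the induction precedes the
    statement about derivatives. *)
Lemma riccati_iterate_spec (T K : R) (q : R -> R) :
  0 < T -> 0 < K -> periodic T q -> (forall t, continuous q t) ->
  forall n,
    periodic T (riccati_iterate T K q n) /\
    forall t, is_derive (riccati_iterate T K q (S n)) t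
      (riccati_forcing K q (riccati_iterate T K q n) t
       - 2 * K * riccati_iterate T K q (S n) t).
Proof.
  intros HT HK Pq Cq.
  assert (step : forall x, periodic T x -> (forall t, continuous x t) ->
    let y := linear_periodic_solution T (fun _ => 2 * K) (riccati_forcing K q x) in
    periodic T y /\
    forall t, is_derive y t (riccati_forcing K q x t - 2 * K * y t)).
  { intros x Px Cx y.
    apply (linear_periodic_solution_spec T (fun _ => 2 * K) (riccati_forcing K q x)).
    - intros; apply continuous_const.
    - intros t; unfold riccati_forcing.
      apply (continuous_minus (V := R_NormedModule)).
      + apply (continuous_plus (V := R_NormedModule)); [apply Cq|].
        apply (continuous_mult (fun _ => 2 * K) x); [apply continuous_const | apply Cx].
      + apply continuous_ext with (fun s => x s * x s); [intros; simpl; ring|].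
        apply (continuous_mult x x); apply Cx.
    - intros t; reflexivity.
    - intros t; unfold riccati_forcing; now rewrite Pq, Px.
    - rewrite RInt_const; unfold scal; simpl; unfold mult; simpl.
      apply Rgt_not_eq; nra. }
  assert (H : forall n, periodic T (riccati_iterate T K q n) /\
                forall t, continuous (riccati_iterate T K q n) t).
  { induction n as [|n [IHp IHc]].
    - split; [intros t; reflexivity | intros; apply continuous_const].
    - destruct (step _ IHp IHc) as [Hp Hd].
      split; [exact Hp|].
      intros t; eapply continuous_of_is_derive, Hd. }
  intros n; split; [apply H|].
  apply (step (riccati_iterate T K q n)); apply H.
Qed.

Lemma riccati_iterate_decreasing (T K : R) (q : R -> R) :
  0 < T -> 0 < K -> periodic T q -> (forall t, continuous q t) ->
  (forall t, q t <= K ^ 2) ->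
  forall n t, riccati_iterate T K q (S n) t <= riccati_iterate T K q n t <= K.
Proof.
  intros HT HK Pq Cq HqK.
  pose proof (riccati_iterate_spec T K q HT HK Pq Cq) as HX.
  induction n as [|n IH].
  - intros t; split; [|apply Rle_refl]; revert t.
    destruct (HX 0%nat) as [_ Hd].
    refine (linear_comparison T (2 * K) _ _ _ (fun _ => 0) HT _ _ _ Hd _ _).
    + lra.
    + apply HX.
    + intros t; reflexivity.
    + intros t; apply (is_derive_const (V := R_NormedModule)).
    + intros t; specialize (HqK t).
      apply Rmult_le_compat_l; [lra|].
      change (riccati_iterate T K q 0) with (fun _ : R => K).
      unfold riccati_forcing; lra.
  - assert (HK' : forall t, riccati_iterate T K q (S n) t <= K).
    { intros t; destruct (IH t); lra. }
    intros t; split; [|apply HK']; revert t.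
    refine (linear_comparison T (2 * K) _ _ _ _ HT _ _ _
              (proj2 (HX (S n))) (proj2 (HX n)) _).
    + lra.
    + apply HX.
    + apply HX.
    + intros t.
      pose proof (riccati_forcing_le K q _ _ t (proj1 (IH t)) (proj2 (IH t))).
      apply Rmult_le_compat_l; lra.
Qed.

Lemma riccati_iterate_ge (T K : R) (q v : R -> R) :
  0 < T -> 0 < K -> periodic T q -> (forall t, continuous q t) ->
  (forall t, q t <= K ^ 2) -> riccati_subsolution T q v ->
  forall n t, v t <= riccati_iterate T K q n t.
Proof.
  intros HT HK Pq Cq HqK Sv.
  pose proof (riccati_iterate_spec T K q HT HK Pq Cq) as HX.
  pose proof (riccati_iterate_decreasing T K q HT HK Pq Cq HqK) as HKn.
  induction n as [|n IH].
  - apply (riccati_subsolution_le T K q v HT HK HqK Sv).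
  - destruct Sv as [Pv [dv [Hd Hv]]].
    refine (linear_comparison T (2 * K) _ _ _ _ HT _ _ _ Hd (proj2 (HX n)) _).
    + lra.
    + exact Pv.
    + apply HX.
    + intros t.
      pose proof (riccati_forcing_le K q _ _ t (IH t) (proj2 (HKn n t))) as H.
      unfold riccati_forcing at 1 in H; specialize (Hv t).
      apply Rmult_le_compat_l; lra.
Qed.

Definition periodic_C1 (T : R) (q : R -> R) : Prop :=
  periodic T q /\
  exists dq, (forall t, is_derive q t (dq t)) /\ forall t, continuous dq t.

Lemma periodic_C1_shift (T c : R) (q : R -> R) :
  periodic_C1 T q -> periodic_C1 T (fun t => q t - c).
Proof.
  intros [Hp [dq [Hd Hc]]]; split; [intros t; now rewrite Hp|].
  exists dq; split; [|exact Hc].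
  intros t; evar_last.
  - apply (is_derive_minus (V := R_NormedModule)); [apply Hd | apply is_derive_const].
  - unfold minus, plus, opp, zero; simpl; ring.
Qed.

Lemma periodic_C1_continuous (T : R) (q : R -> R) :
  periodic_C1 T q -> forall t, continuous q t.
Proof. intros [_ [dq [Hd _]]] t; eapply continuous_of_is_derive, Hd. Qed.

Lemma periodic_C1_bounds (T : R) (q : R -> R) :
  0 < T -> periodic_C1 T q ->
  exists M L, 0 < M /\ 0 < L /\ (forall t, Rabs (q t) <= M) /\
              forall s t, Rabs (q t - q s) <= L * Rabs (t - s).
Proof.
  intros HT Hq.
  destruct (periodic_continuous_bounded T q HT) as [M [HM HqM]].
  { apply Hq. }
  { now apply periodic_C1_continuous with T. }
  destruct Hq as [Hp [dq [Hd Hc]]].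
  destruct (periodic_continuous_bounded T dq HT) as [L [HL HqL]].
  { now apply periodic_derivative with q. }
  { exact Hc. }
  exists M, L; repeat split; auto.
  now apply lipschitz_of_derive_bounded with dq.
Qed.

Lemma square_lipschitz (B D x y h : R) :
  Rabs x <= B -> Rabs y <= B -> Rabs (x - y) <= D * h -> 
  Rabs (x ^ 2 - y ^ 2) <= 2 * B * D * h.
Proof.
  intros Hx Hy Hxy.
  replace (x ^ 2 - y ^ 2) with ((x + y) * (x - y)) by ring.
  rewrite Rabs_mult.
  replace (2 * B * D * h) with ((B + B) * (D * h)) by ring.
  apply Rmult_le_compat; try apply Rabs_pos; [|exact Hxy].
  eapply Rle_trans; [apply Rabs_triang | lra].
Qed.

(** The iterates started at a large constant [K] decrease and stay above every
    subsolution, so their limit is a solution above every subsolution.  One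
    subsolution [v0] is needed to bound them from below. *)
Lemma riccati_maximal_solution (T : R) (q v0 : R -> R) :
  0 < T -> periodic_C1 T q -> riccati_subsolution T q v0 ->
  exists w, riccati_solution T q w /\
            forall v, riccati_subsolution T q v -> forall t, v t <= w t.
Proof.
  intros HT Hq Sv0.
  destruct (periodic_C1_bounds T q HT Hq) as [M [L [HM [HL [HqM HqL]]]]].
  pose proof (periodic_C1_continuous T q Hq) as Cq.
  destruct Hq as [Pq _].
  (* [M <= (M + 1)^2] whatever the size of [M] *)
  set (K := M + 1).
  assert (HK : 0 < K) by (unfold K; lra).
  assert (HqK : forall t, q t <= K ^ 2).
  { intros t; specialize (HqM t); apply Rabs_le_between in HqM; unfold K; nra. }
  pose proof (riccati_iterate_spec T K q HT HK Pq Cq) as HX.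
  pose proof (riccati_iterate_decreasing T K q HT HK Pq Cq HqK) as Hdecr.
  pose proof (fun v => riccati_iterate_ge T K q v HT HK Pq Cq HqK) as Hge.
  set (X := riccati_iterate T K q) in *.
  set (w := fun t => real (Lim_seq (fun n => X n t))).
  assert (Hlim : forall t, is_lim_seq (fun n => X n t) (w t)).
  { intros t; apply Lim_seq_correct'.
    apply ex_finite_lim_seq_decr with (v0 t); intros n; [apply Hdecr | now apply Hge]. }
  assert (Hlow : exists N, 0 < N /\ forall t, Rabs (v0 t) <= N).
  { destruct Sv0 as [Pv0 [dv0 [Hd0 _]]].
    apply (periodic_continuous_bounded T); auto.
    intros t; eapply continuous_of_is_derive, Hd0. }
  destruct Hlow as [N [HN HvN]].
  set (B := N + K).
  assert (HXB : forall n t, Rabs (X n t) <= B).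
  { intros n t; apply Rabs_le; unfold B.
    pose proof (Hge v0 Sv0 n t); pose proof (proj2 (Hdecr n t)).
    specialize (HvN t); apply Rabs_le_between in HvN; lra. }
  set (D := M + 2 * K * B + B ^ 2 + 2 * K * B).
  assert (HB : 0 < B) by (unfold B; lra).
  assert (HD : 0 <= D) by (unfold D; nra).
  assert (HdX : forall n t,
    Rabs (riccati_forcing K q (X n) t - 2 * K * X (S n) t) <= D).
  { intros n t; unfold riccati_forcing, D.
    pose proof (HXB n t) as H1; pose proof (HXB (S n) t) as H2; specialize (HqM t).
    apply Rabs_le_between in H1, H2, HqM.
    apply Rabs_le; split; nra. }
  assert (HXL : forall n s t, Rabs (X n t - X n s) <= D * Rabs (t - s)).
  { intros [|n] s t.
    - simpl; rewrite Rminus_eq_0, Rabs_R0.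
      apply Rmult_le_pos; [exact HD | apply Rabs_pos].
    - apply (lipschitz_of_derive_bounded _ _ D (proj2 (HX n))), HdX. }
  exists w; split; [split|].
  - intros t; unfold w; f_equal; apply Lim_seq_ext; intros n; apply HX.
  - apply (is_derive_limit (fun n => X (S n))
      (fun n t => riccati_forcing K q (X n) t - 2 * K * X (S n) t) _ _
      (L + 2 * K * D + 2 * B * D + 2 * K * D)).
    + intros n; apply HX.
    + intros n s t; unfold riccati_forcing.
      pose proof (HqL s t) as H1; pose proof (HXL n s t) as H2.
      pose proof (HXL (S n) s t) as H3.
      pose proof (square_lipschitz B D _ _ _ (HXB n t) (HXB n s) H2) as H4.
      apply Rabs_le_between in H1, H2, H3, H4.
      apply Rabs_le; split; nra.
    + intros t; apply (is_lim_seq_incr_1 (fun n => X n t)), Hlim.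
    + intros t.
      replace (q t - w t ^ 2)
        with (q t + 2 * K * w t - w t * (w t * 1) - 2 * K * w t) by ring.
      unfold riccati_forcing; simpl pow.
      apply is_lim_seq_minus'; [apply is_lim_seq_minus'; [apply is_lim_seq_plus'|]|].
      * apply is_lim_seq_const.
      * apply (is_lim_seq_scal_l _ _ (Finite (w t))), Hlim.
      * apply is_lim_seq_mult'; [apply Hlim | apply is_lim_seq_mult'; [apply Hlim|]].
        apply is_lim_seq_const.
      * apply (is_lim_seq_scal_l _ _ (Finite (w t))).
        apply (is_lim_seq_incr_1 (fun n => X n t)), Hlim.
  - intros v Sv t.
    exact (is_lim_seq_le _ _ (v t) (w t) (fun n => Hge v Sv n t)
             (is_lim_seq_const (v t)) (Hlim t)).
Qed.

(** The largest solutions at parameters [mu n] increasing to [lam] decrease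
    with [n], since a solution at a larger parameter is a subsolution at a
    smaller one.  They are bounded by a common constant, so they converge to a
    solution at [lam]. *)
Lemma riccati_solution_left_closed (T lam : R) (p : R -> R) :
  0 < T -> periodic_C1 T p ->
  (forall mu, mu < lam -> exists w, riccati_solution T (fun t => p t - mu) w) ->
  exists w, riccati_solution T (fun t => p t - lam) w.
Proof.
  intros HT Hp Hsol.
  set (mu := fun n => lam - / (INR n + 1)).
  assert (Hinv : forall n, 0 < / (INR n + 1)).
  { intros n; apply Rinv_0_lt_compat; pose proof (pos_INR n); lra. }
  assert (Hmu : forall n, mu n < lam) by (intros n; unfold mu; specialize (Hinv n); lra).
  assert (HmuS : forall n, mu n <= mu (S n)).
  { intros n; unfold mu; rewrite S_INR; pose proof (pos_INR n).
    assert (/ (INR n + 1 + 1) <= / (INR n + 1)) by (apply Rinv_le_contravar; lra).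
    lra. }
  assert (Hmu1 : forall n, lam - 1 <= mu n).
  { intros n; unfold mu; pose proof (pos_INR n).
    assert (/ (INR n + 1) <= / 1) by (apply Rinv_le_contravar; lra).
    rewrite Rinv_1 in H0; lra. }
  assert (Hmax : forall n, exists w, riccati_solution T (fun t => p t - mu n) w /\
    forall v, riccati_subsolution T (fun t => p t - mu n) v -> forall t, v t <= w t).
  { intros n; destruct (Hsol (mu n) (Hmu n)) as [w0 Hw0].
    apply riccati_maximal_solution with w0; auto using periodic_C1_shift.
    apply (riccati_solution_subsolution _ _ _ _ Hw0); intros; apply Rle_refl. }
  set (W := fun n => proj1_sig (constructive_indefinite_description _ (Hmax n))).
  assert (HW : forall n, riccati_solution T (fun t => p t - mu n) (W n) /\
    forall v, riccati_subsolution T (fun t => p t - mu n) v -> forall t, v t <= W n t).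
  { intros n; unfold W; apply proj2_sig. }
  clearbody W.
  destruct (periodic_C1_bounds T p HT Hp) as [M [L [HM [HL [HpM HpL]]]]].
  set (K := M + Rabs lam + 1).
  pose proof (Rabs_pos lam) as Hlam0.
  assert (HK : 0 < K) by (unfold K; lra).
  assert (Hq : forall n t, Rabs (p t - mu n) <= K).
  { intros n t; specialize (HpM t); specialize (Hmu n); specialize (Hmu1 n).
    pose proof (Rle_abs lam); pose proof (Rle_abs (- lam)) as H0.
    rewrite Rabs_Ropp in H0.
    apply Rabs_le_between in HpM; apply Rabs_le; unfold K; lra. }
  assert (HqK : forall n t, p t - mu n <= K ^ 2).
  { intros n t; pose proof (Hq n t) as H; apply Rabs_le_between in H.
    assert (1 <= K) by (unfold K; lra); nra. }
  assert (HWK : forall n t, Rabs (W n t) <= K).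
  { intros n t; apply Rabs_le; split.
    - apply (riccati_solution_ge T K _ _ HT HK (HqK n)), HW.
    - apply (riccati_subsolution_le T K _ _ HT HK (HqK n)).
      apply (riccati_solution_subsolution _ _ _ _ (proj1 (HW n))).
      intros; apply Rle_refl. }
  set (w := fun t => real (Lim_seq (fun n => W n t))).
  assert (Hlim : forall t, is_lim_seq (fun n => W n t) (w t)).
  { intros t; apply Lim_seq_correct'.
    apply ex_finite_lim_seq_decr with (- K); intros n.
    - apply (HW n), (riccati_solution_subsolution _ _ _ _ (proj1 (HW (S n)))).
      intros s; specialize (HmuS n); lra.
    - apply (proj1 (Rabs_le_between _ _) (HWK n t)). }
  set (D := K + K ^ 2).
  assert (HWD : forall n t, Rabs (p t - mu n - W n t ^ 2) <= D).
  { intros n t; unfold D.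
    pose proof (Hq n t) as H1; pose proof (HWK n t) as H2.
    apply Rabs_le_between in H1, H2; apply Rabs_le; split; nra. }
  exists w; split.
  - intros t; unfold w; f_equal; apply Lim_seq_ext; intros n; apply HW.
  - apply (is_derive_limit W (fun n t => p t - mu n - W n t ^ 2) _ _ (L + 2 * K * D)).
    + intros n; apply HW.
    + intros n s t.
      pose proof (lipschitz_of_derive_bounded _ _ D (proj2 (proj1 (HW n))) (HWD n) s t) as H1.
      pose proof (square_lipschitz K D _ _ _ (HWK n t) (HWK n s) H1) as H2.
      pose proof (HpL s t) as H3.
      apply Rabs_le_between in H2, H3; apply Rabs_le; split; nra.
    + exact Hlim.
    + intros t; simpl pow.
      apply is_lim_seq_minus'; [apply is_lim_seq_minus'; [apply is_lim_seq_const|]|].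
      * unfold mu; replace (Finite lam) with (Finite (lam - 0)) by (f_equal; ring).
        apply is_lim_seq_minus'; [apply is_lim_seq_const|].
        apply is_lim_seq_ext with (fun n => / INR (S n)); [intros; now rewrite S_INR|].
        apply (is_lim_seq_incr_1 (fun n => / INR n)).
        apply (is_lim_seq_inv _ p_infty); [apply is_lim_seq_INR | discriminate].
      * apply is_lim_seq_mult'; [apply Hlim | apply is_lim_seq_mult'; [apply Hlim|]].
        apply is_lim_seq_const.
Qed.

(** * The lowest periodic eigenvalue *)

(** The function [F = y y' - w y^2] is periodic, and if [mu < lam] its
    derivative [(y' - w y)^2 + (lam - mu) y^2] is nonnegative, hence zero, so
    that the eigenfunction [y] would vanish. *)
Lemma riccati_solution_le_eigenvalue (p w : R -> R) (lam mu : R) :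
  riccati_solution PI (fun t => p t - lam) w -> periodic_eigenvalue p mu ->
  lam <= mu.
Proof.
  intros [Pw Hw] [y [Hy [Py [t0 Ht0]]]].
  destruct (Rle_lt_dec lam mu) as [|Hlt]; [assumption | exfalso].
  assert (Dy : forall t, is_derive y t (Derive y t)).
  { intros t; apply Derive_correct, Hy. }
  assert (D2y : forall t, is_derive (Derive y) t ((p t - mu) * y t)).
  { intros t; destruct (Hy t) as [_ [H1 H2]].
    apply is_derive_value with (1 := Derive_correct _ _ H1); lra. }
  pose proof (periodic_derivative PI y (Derive y) Py Dy) as PDy.
  set (F := fun t => y t * Derive y t - w t * (y t * y t)).
  set (dF := fun t => (Derive y t - w t * y t) ^ 2 + (lam - mu) * y t ^ 2).
  assert (HF : forall t, is_derive F t (dF t)).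
  { intros t; unfold F; evar_last.
    - apply (is_derive_minus (V := R_NormedModule)).
      + apply is_derive_mul; [apply Dy | apply D2y].
      + apply is_derive_mul; [apply Hw | apply is_derive_mul; apply Dy].
    - unfold dF, minus, plus, opp; simpl; ring. }
  assert (Hpos : forall t, 0 <= dF t).
  { intros t; unfold dF.
    pose proof (pow2_ge_0 (Derive y t - w t * y t)); pose proof (pow2_ge_0 (y t)); nra. }
  assert (H0 : dF t0 = 0).
  { apply (periodic_nondecreasing_derive_zero PI F dF PI_RGT_0); auto.
    intros t; unfold F; now rewrite Py, PDy, Pw. }
  unfold dF in H0.
  pose proof (pow2_ge_0 (Derive y t0 - w t0 * y t0)).
  pose proof (pow2_gt_0 (y t0) Ht0); nra.
Qed.

(** The eigenfunction is [exp] of a primitive of [w]; it is periodic since the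
    integral of [w] over a period is zero. *)
Lemma eigenvalue_of_riccati_mean_zero (p w : R -> R) (lam : R) :
  riccati_solution PI (fun t => p t - lam) w -> RInt w 0 PI = 0 ->
  periodic_eigenvalue p lam.
Proof.
  intros [Pw Hw] Hz.
  assert (Cw : forall t, continuous w t).
  { intros t; eapply continuous_of_is_derive, Hw. }
  pose proof (fun t => is_derive_exp_primitive w t Cw) as Hy.
  set (y := exp_primitive w) in *.
  assert (H2 : forall t, is_derive (Derive y) t ((p t - lam) * y t)).
  { intros t; apply is_derive_ext with (fun s => w s * y s).
    - intros s; symmetry; apply is_derive_unique, Hy.
    - evar_last.
      + apply is_derive_mul; [apply Hw | apply Hy].
      + ring. }
  exists y; split; [|split].
  - intros t; split; [|split].
    + eexists; apply Hy.
    + eexists; apply H2.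
    + rewrite (is_derive_unique _ _ _ (H2 t)); ring.
  - intros t; unfold y; rewrite exp_primitive_shift by assumption.
    unfold exp_primitive at 1; rewrite Hz, exp_0; ring.
  - exists 0; apply Rgt_not_eq, exp_pos.
Qed.

(** With [h' + 2 w h = - 1], the function [v = w + e h] satisfies
    [v' + v^2 = q - e + e^2 h^2], and [h] is bounded.  The nonzero mean of [w]
    is what allows a periodic [h]. *)
Lemma riccati_subsolution_beyond (T : R) (q w : R -> R) :
  0 < T -> riccati_solution T q w -> RInt w 0 T <> 0 ->
  exists s v, 0 < s /\ riccati_subsolution T (fun t => q t - s) v.
Proof.
  intros HT [Pw Hw] Hnz.
  assert (Cw : forall t, continuous w t).
  { intros t; eapply continuous_of_is_derive, Hw. }
  destruct (linear_periodic_solution_spec T (fun t => 2 * w t) (fun _ => - 1))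
    as [Ph Hh].
  - intros t; apply (continuous_scal_r (V := R_NormedModule) 2 w), Cw.
  - intros t; apply continuous_const.
  - intros t; now rewrite Pw.
  - intros t; reflexivity.
  - assert (E : RInt (fun t => 2 * w t) 0 T = 2 * RInt w 0 T).
    { apply (RInt_scal (V := R_CompleteNormedModule)), ex_RInt_continuous.
      intros; apply Cw. }
    lra.
  - set (h := linear_periodic_solution T _ _) in *.
    destruct (periodic_continuous_bounded T h HT Ph) as [H [HH Hb]].
    { intros t; eapply continuous_of_is_derive, Hh. }
    (* [e] is small enough that [e h^2 <= 1/2], so half of the gain [e] remains *)
    set (e := / (2 * (H ^ 2 + 1))).
    assert (He : 0 < e) by (apply Rinv_0_lt_compat; nra).
    assert (HeH : e * (2 * (H ^ 2 + 1)) = 1) by (unfold e; field; nra).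
    exists (e / 2), (fun t => w t + e * h t); split; [lra|]; split.
    + intros t; now rewrite Pw, Ph.
    + exists (fun t => (q t - w t ^ 2) + e * (- 1 - 2 * w t * h t)); split.
      * intros t; apply (is_derive_plus (V := R_NormedModule)); [apply Hw|].
        apply is_derive_scal, Hh.
      * intros t; specialize (Hb t); apply Rabs_le_between in Hb.
        assert (h t ^ 2 <= H ^ 2) by nra.
        assert (e * h t ^ 2 <= / 2) by nra.
        replace (q t - w t ^ 2 + e * (-1 - 2 * w t * h t) + (w t + e * h t) ^ 2)
          with (q t - e + e * (e * h t ^ 2)) by ring.
        nra.
Qed.

(** The supremum [top] of the parameters with a periodic solution is itself a
    periodic eigenvalue, hence at least [lam0]. *)
Lemma riccati_solution_of_le_lowest_eigenvalue (p : R -> R) (lam lam0 : R) :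
  periodic_C1 PI p -> lowest_periodic_eigenvalue p lam0 -> lam <= lam0 ->
  exists w, riccati_solution PI (fun t => p t - lam) w.
Proof.
  intros Hp [Hev Hlow] Hle.
  assert (Hsub : forall mu v, riccati_subsolution PI (fun t => p t - mu) v ->
    exists w, riccati_solution PI (fun t => p t - mu) w).
  { intros mu v Hv.
    destruct (riccati_maximal_solution PI (fun t => p t - mu) v PI_RGT_0) as [w [Hw _]];
      auto using periodic_C1_shift.
    now exists w. }
  set (S := fun mu => exists w, riccati_solution PI (fun t => p t - mu) w).
  assert (Hdown : forall mu nu, S nu -> mu <= nu -> S mu).
  { intros mu nu [w Hw] Hmn; apply Hsub with w.
    apply (riccati_solution_subsolution _ _ _ _ Hw); intros; lra. }
  destruct (completeness S) as [top [Hub Hlub]].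
  - exists lam0; intros mu [w Hw].
    now apply riccati_solution_le_eigenvalue with p w.
  - destruct (periodic_C1_bounds PI p PI_RGT_0 Hp) as [M [_ [_ [_ [HpM _]]]]].
    exists (- M); apply (Hsub _ (fun _ => 0)); split; [intros t; reflexivity|].
    exists (fun _ => 0); split.
    + intros t; apply (is_derive_const (V := R_NormedModule)).
    + intros t; specialize (HpM t); apply Rabs_le_between in HpM; nra.
  - assert (Hbelow : forall mu, mu < top -> S mu).
    { intros mu Hmu.
      destruct (classic (S mu)) as [|Hn]; [assumption | exfalso].
      apply (Rlt_not_le _ _ Hmu), Hlub; intros nu Hnu.
      destruct (Rle_lt_dec nu mu) as [|Hlt]; [assumption | exfalso].
      apply Hn, (Hdown mu nu Hnu); lra. }
    destruct (riccati_solution_left_closed PI top p PI_RGT_0 Hp Hbelow) as [w Hw].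
    assert (Hmean : RInt w 0 PI = 0).
    { destruct (Req_dec (RInt w 0 PI) 0) as [|Hnz]; [assumption | exfalso].
      destruct (riccati_subsolution_beyond PI _ w PI_RGT_0 Hw Hnz) as [s [v [Hs [Pv [dv [Dv Hv]]]]]].
      assert (HS : S (top + s)).
      { apply (Hsub _ v); split; [exact Pv|]; exists dv; split; [exact Dv|].
        intros t; specialize (Hv t); lra. }
      apply Hub in HS; lra. }
    apply (Hdown lam top); [now exists w|].
    apply Rle_trans with lam0; [exact Hle|].
    apply Hlow, (eigenvalue_of_riccati_mean_zero p w); assumption.
Qed.

(** * Smooth functions *)

(** A finite order of smoothness is what the bootstrap for solutions of the
    Riccati equation improves by one at each step. *)
Definition smooth_upto (n : nat) (f : R -> R) : Prop :=
  forall k t, (k <= n)%nat -> ex_derive_n f k t.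

Lemma smooth_upto_S (n : nat) (f : R -> R) :
  smooth_upto (S n) f <-> (forall t, ex_derive f t) /\ smooth_upto n (Derive f).
Proof.
  assert (E : forall k t, ex_derive_n (Derive f) k t <->
                (k = 0%nat \/ ex_derive_n f (S k) t)).
  { intros [|k] t.
    - split; [now left | intros _; exact I].
    - assert (Hd : forall s, Derive_n (Derive f) k s = Derive_n f (S k) s).
      { intros s; change (Derive f) with (Derive_n f 1).
        rewrite Derive_n_comp, Nat.add_1_r; reflexivity. }
      split.
      + intros H; right; revert H; apply ex_derive_ext, Hd.
      + intros [H | H]; [discriminate|]; revert H; apply ex_derive_ext.
        intros s; symmetry; apply Hd. }
  split.
  - intros H; split.
    + intros t; apply (H 1%nat t); lia.
    + intros k t Hk; apply E; right; apply H; lia.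
  - intros [H1 H2] [|[|k]] t Hk.
    + exact I.
    + apply H1.
    + destruct (proj1 (E (S k) t)) as [H | H]; [apply H2; lia | discriminate | exact H].
Qed.

Lemma smooth_upto_le (m n : nat) (f : R -> R) :
  (m <= n)%nat -> smooth_upto n f -> smooth_upto m f.
Proof. intros Hmn H k t Hk; apply H; lia. Qed.

Lemma smooth_upto_ext (n : nat) (f g : R -> R) :
  (forall t, f t = g t) -> smooth_upto n f -> smooth_upto n g.
Proof. intros E H k t Hk; apply (ex_derive_n_ext f); auto. Qed.

Lemma smooth_upto_plus (n : nat) (f g : R -> R) :
  smooth_upto n f -> smooth_upto n g -> smooth_upto n (fun t => f t + g t).
Proof.
  intros Hf Hg k t Hk; apply ex_derive_n_plus;
    exists (mkposreal 1 Rlt_0_1); intros s _ j Hj; [apply Hf | apply Hg]; lia.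
Qed.

Lemma smooth_upto_scal (n : nat) (a : R) (f : R -> R) :
  smooth_upto n f -> smooth_upto n (fun t => a * f t).
Proof. intros Hf k t Hk; now apply ex_derive_n_scal_l, Hf. Qed.

Lemma smooth_upto_const (n : nat) (a : R) : smooth_upto n (fun _ => a).
Proof. intros k t _; apply ex_derive_n_const. Qed.

Lemma smooth_upto_mult (n : nat) : forall f g : R -> R,
  smooth_upto n f -> smooth_upto n g -> smooth_upto n (fun t => f t * g t).
Proof.
  induction n as [|n IH]; intros f g Hf Hg.
  - intros k t Hk; replace k with 0%nat by lia; exact I.
  - pose proof (smooth_upto_le n _ f (Nat.le_succ_diag_r n) Hf) as Hf0.
    pose proof (smooth_upto_le n _ g (Nat.le_succ_diag_r n) Hg) as Hg0.
    apply smooth_upto_S in Hf, Hg; destruct Hf as [Df Hf], Hg as [Dg Hg].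
    apply smooth_upto_S; split.
    + intros t; apply (ex_derive_mult f g t (Df t) (Dg t)).
    + apply smooth_upto_ext with (fun t => Derive f t * g t + f t * Derive g t).
      * intros t; symmetry; apply Derive_mult; auto.
      * apply smooth_upto_plus; apply IH; assumption.
Qed.

Lemma riccati_solution_smooth (T : R) (q w : R -> R) :
  (forall n, smooth_upto n q) -> riccati_solution T q w ->
  forall n, smooth_upto n w.
Proof.
  intros Hq [_ Hw]; induction n as [|n IH].
  - intros k t Hk; replace k with 0%nat by lia; exact I.
  - apply smooth_upto_S; split; [intros t; eexists; apply Hw|].
    apply smooth_upto_ext with (fun t => q t + (- 1) * (w t * w t)).
    + intros t; rewrite (is_derive_unique _ _ _ (Hw t)); ring.
    + apply smooth_upto_plus; [apply Hq|].
      now apply smooth_upto_scal, smooth_upto_mult.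
Qed.

(** * Centroaffine curves *)

Lemma smooth_curve_iff (g : R -> R * R) :
  smooth_curve g <-> forall n, smooth_upto n (fun t => fst (g t)) /\
                               smooth_upto n (fun t => snd (g t)).
Proof.
  split.
  - intros H n; split; intros k t _; apply H.
  - intros H n t; destruct (H n) as [H1 H2]; split; [apply H1 | apply H2]; lia.
Qed.

Lemma smooth_curve_velocity (g : R -> R * R) :
  smooth_curve g -> smooth_curve (velocity g).
Proof.
  rewrite !smooth_curve_iff; intros H n; destruct (H (S n)) as [H1 H2].
  apply smooth_upto_S in H1, H2; split; [apply H1 | apply H2].
Qed.

Lemma smooth_curve_is_derive (g : R -> R * R) (t : R) :
  smooth_curve g ->
  is_derive (fun s => fst (g s)) t (fst (velocity g t)) /\
  is_derive (fun s => snd (g s)) t (snd (velocity g t)).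
Proof.
  intros H; destruct (H 1%nat t) as [H1 H2].
  split; apply Derive_correct; assumption.
Qed.

Lemma velocity_anti_periodic (g : R -> R * R) :
  smooth_curve g -> anti_periodic g -> anti_periodic (velocity g).
Proof.
  intros Sg Ag t.
  assert (E : forall (f : R -> R), (forall s, ex_derive f s) ->
    (forall s, f (s + PI) = - f s) -> Derive f (t + PI) = - Derive f t).
  { intros f Df Hf; rewrite <- Derive_opp; symmetry; apply is_derive_unique.
    apply is_derive_ext with (fun s => f (s + PI)); [intros s; apply Hf|].
    apply is_derive_shift, Derive_correct, Df. }
  apply injective_projections; simpl; apply E;
    try (intros s; apply (Sg 1%nat s)); intros s; now rewrite Ag.
Qed.

Lemma curvature_eq_det2 (g : R -> R * R) (p : R -> R) (t : R) :
  centroaffine g -> centroaffine_curvature g p ->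
  p t = det2 (velocity (velocity g) t) (velocity g t).
Proof.
  intros [_ Hg] Hp; specialize (Hg t); rewrite Hp.
  transitivity (p t * det2 (g t) (velocity g t)); [rewrite Hg; ring|].
  unfold det2, scal; simpl; unfold prod_scal, scal; simpl; unfold mult; simpl. ring.
Qed.

Lemma det2_opp (u v : R * R) : det2 (opp u) (opp v) = det2 u v.
Proof. unfold det2, opp; simpl; unfold prod_opp, opp; simpl. ring. Qed.

Lemma curvature_smooth (g : R -> R * R) (p : R -> R) :
  centroaffine g -> centroaffine_curvature g p -> forall n, smooth_upto n p.
Proof.
  intros Hg Hp n.
  pose proof (smooth_curve_velocity _ (proj1 Hg)) as S1.
  pose proof (smooth_curve_velocity _ S1) as S2.
  apply smooth_curve_iff with (n := n) in S1; apply smooth_curve_iff with (n := n) in S2.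
  apply smooth_upto_ext with
    (fun t => fst (velocity (velocity g) t) * snd (velocity g t)
              + - 1 * (snd (velocity (velocity g) t) * fst (velocity g t))).
  - intros t; rewrite (curvature_eq_det2 g p t Hg Hp); unfold det2; ring.
  - apply smooth_upto_plus; [|apply smooth_upto_scal]; apply smooth_upto_mult; tauto.
Qed.

Lemma curvature_periodic_C1 (g : R -> R * R) (p : R -> R) :
  centroaffine g -> anti_periodic g -> centroaffine_curvature g p ->
  periodic_C1 PI p.
Proof.
  intros Hg Ag Hp.
  pose proof (velocity_anti_periodic g (proj1 Hg) Ag) as A1.
  pose proof (smooth_curve_velocity _ (proj1 Hg)) as S1.
  pose proof (velocity_anti_periodic _ S1 A1) as A2.
  split.
  - intros t; rewrite !(curvature_eq_det2 g p _ Hg Hp), A1, A2; apply det2_opp.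
  - pose proof (curvature_smooth g p Hg Hp) as Sp.
    exists (Derive p); split; intros t.
    + apply Derive_correct, (Sp 1%nat 1%nat t); lia.
    + apply (ex_derive_continuous (Derive p)), (Sp 2%nat 2%nat t); lia.
Qed.

(** The coefficient [a] of [d = a g + c g'] is [det2 d g'].  The computation of
    its derivative rests on the Pluecker relation between the six determinants
    of [g], [d], [g'], [d']. *)
Lemma riccati_of_c_related (g d : R -> R * R) (p : R -> R) (c : R) :
  c <> 0 -> centroaffine g -> anti_periodic g -> centroaffine_curvature g p ->
  centroaffine d -> anti_periodic d -> c_related c g d ->
  riccati_solution PI (fun t => p t - (- / c ^ 2))
    (fun t => - / c * det2 (d t) (velocity g t)).
Proof.
  intros Hc [Sg Ug] Ag Hp [Sd Ud] Ad Hcd; split.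
  - intros t; now rewrite Ad, (velocity_anti_periodic g Sg Ag), det2_opp.
  - intros t.
    destruct (smooth_curve_is_derive g t Sg) as [G1 G2].
    destruct (smooth_curve_is_derive (velocity g) t (smooth_curve_velocity g Sg)) as [V1 V2].
    destruct (smooth_curve_is_derive d t Sd) as [D1 D2].
    rewrite (Hp t) in V1, V2.
    (* differentiating [det2 g d = c] gives [det2 g d' = det2 d g'] *)
    assert (HW : is_derive (fun s => det2 (g s) (d s)) t 0).
    { apply is_derive_ext with (fun _ => c); [intros s; symmetry; apply Hcd|].
      apply (is_derive_const (V := R_NormedModule)). }
    assert (HW' : is_derive (fun s => det2 (g s) (d s)) t
      (det2 (velocity g t) (d t) + det2 (g t) (velocity d t))).
    { unfold det2; evar_last.
      - apply (is_derive_minus (V := R_NormedModule)); apply is_derive_mul; eassumption.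
      - unfold minus, plus, opp; simpl; ring. }
    pose proof (eq_trans (eq_sym (is_derive_unique _ _ _ HW')) (is_derive_unique _ _ _ HW)) as E.
    evar_last.
    + apply is_derive_scal; unfold det2.
      apply (is_derive_minus (V := R_NormedModule)); apply is_derive_mul; eassumption.
    + specialize (Ug t); specialize (Ud t); specialize (Hcd t).
      assert (Plucker : det2 (g t) (d t) * det2 (velocity d t) (velocity g t)
        = det2 (g t) (velocity d t) * det2 (d t) (velocity g t)
          - det2 (g t) (velocity g t) * det2 (d t) (velocity d t))
        by (unfold det2; ring).
      assert (E' : det2 (g t) (velocity d t) = det2 (d t) (velocity g t)).
      { unfold det2 in E |- *; lra. }
      rewrite Ug, Ud, Hcd, E' in Plucker.
      transitivity (- / c * (det2 (velocity d t) (velocity g t)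
                             - p t * det2 (g t) (d t))).
      * unfold det2, scal, minus, plus, opp; simpl.
        unfold prod_scal, scal; simpl; unfold mult; simpl; ring.
      * rewrite Hcd.
        replace (det2 (velocity d t) (velocity g t))
          with ((det2 (d t) (velocity g t) * det2 (d t) (velocity g t) - 1 * 1) / c)
          by (rewrite <- Plucker; field; exact Hc).
        field; exact Hc.
Qed.

Lemma c_related_of_riccati (g : R -> R * R) (p w : R -> R) (c : R) :
  c <> 0 -> centroaffine g -> anti_periodic g -> centroaffine_curvature g p ->
  riccati_solution PI (fun t => p t - (- / c ^ 2)) w ->
  exists d, centroaffine d /\ anti_periodic d /\ c_related c g d.
Proof.
  intros Hc Hg Ag Hp Hw.
  set (a := fun t => - c * w t).
  set (d := fun t => (a t * fst (g t) + c * fst (velocity g t),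
                      a t * snd (g t) + c * snd (velocity g t))).
  assert (Sw : forall n, smooth_upto n w).
  { apply (riccati_solution_smooth PI _ w) with (2 := Hw).
    intros n; apply smooth_upto_plus; [|apply smooth_upto_const].
    now apply curvature_smooth with g. }
  pose proof (velocity_anti_periodic g (proj1 Hg) Ag) as Av.
  pose proof (smooth_curve_velocity g (proj1 Hg)) as Sv.
  destruct Hg as [Sg Ug], Hw as [Pw Dw].
  exists d; split; [split|split].
  - apply smooth_curve_iff; intros n.
    destruct (proj1 (smooth_curve_iff g) Sg n) as [G1 G2].
    destruct (proj1 (smooth_curve_iff _) Sv n) as [V1 V2].
    assert (Sa : smooth_upto n a) by (apply smooth_upto_scal, Sw).
    split; simpl; apply smooth_upto_plus;
      try (apply smooth_upto_mult; assumption); now apply smooth_upto_scal.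
  - intros t.
    destruct (smooth_curve_is_derive g t Sg) as [G1 G2].
    destruct (smooth_curve_is_derive (velocity g) t Sv) as [V1 V2].
    rewrite (Hp t) in V1, V2.
    set (da := - c * (p t - - / c ^ 2 - w t ^ 2)).
    assert (Da : is_derive a t da) by (apply is_derive_scal, Dw).
    assert (D : forall (x vx : R -> R) (dx dvx : R),
      is_derive x t dx -> is_derive vx t dvx ->
      Derive (fun s => a s * x s + c * vx s) t = (da * x t + a t * dx) + c * dvx).
    { intros x vx dx dvx Hx Hvx; apply is_derive_unique.
      apply (is_derive_plus (V := R_NormedModule)).
      - now apply is_derive_mul.
      - now apply is_derive_scal. }
    assert (Vd : velocity d t =
      (da * fst (g t) + a t * fst (velocity g t) + c * (p t * fst (g t)),
       da * snd (g t) + a t * snd (velocity g t) + c * (p t * snd (g t)))).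
    { unfold velocity at 1; simpl; f_equal; apply D; assumption. }
    rewrite Vd; specialize (Ug t).
    transitivity ((a t ^ 2 - c * (da + c * p t)) * det2 (g t) (velocity g t)).
    + unfold det2, d; simpl; ring.
    + rewrite Ug; unfold a, da; field; exact Hc.
  - intros t; specialize (Ag t); specialize (Av t).
    unfold d, a; rewrite Pw, Ag, Av.
    apply injective_projections; unfold opp; simpl; unfold prod_opp, opp; simpl; ring.
  - intros t; specialize (Ug t).
    transitivity (c * det2 (g t) (velocity g t)); [|rewrite Ug; ring].
    unfold det2, d; simpl. ring.
Qed.

Lemma Rabs_le_inv_sqrt (c l : R) :
  c <> 0 -> l < 0 -> (Rabs c <= 1 / sqrt (- l) <-> - / c ^ 2 <= l).
Proof.
  intros Hc Hl.
  assert (Hs : 0 < sqrt (- l)) by (apply sqrt_lt_R0; lra).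
  assert (Hss : sqrt (- l) * sqrt (- l) = - l) by (apply sqrt_sqrt; lra).
  assert (Ha : 0 < Rabs c) by (now apply Rabs_pos_lt).
  assert (Hc2 : c ^ 2 = Rabs c * Rabs c) by (rewrite <- pow2_abs; ring).
  assert (Hi : / c ^ 2 * c ^ 2 = 1) by (apply Rinv_l, pow_nonzero, Hc).
  assert (Hi0 : 0 < c ^ 2) by (rewrite Hc2; nra).
  transitivity (Rabs c * sqrt (- l) <= 1).
  - split; intros H.
    + apply (Rmult_le_compat_r (sqrt (- l))) in H; [|lra].
      unfold Rdiv in H; rewrite Rmult_assoc, Rinv_l in H; lra.
    + apply (Rmult_le_reg_r (sqrt (- l))); [exact Hs|].
      unfold Rdiv; rewrite Rmult_assoc, Rinv_l; lra.
  - transitivity ((Rabs c * sqrt (- l)) * (Rabs c * sqrt (- l)) <= 1).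
    + assert (0 < Rabs c * sqrt (- l)) by (now apply Rmult_lt_0_compat).
      split; intros H1; nra.
    + replace (Rabs c * sqrt (- l) * (Rabs c * sqrt (- l)))
        with (Rabs c * Rabs c * (sqrt (- l) * sqrt (- l))) by ring.
      rewrite Hss, <- Hc2.
      split; intros H.
      * apply (Rmult_le_reg_r (c ^ 2)); [exact Hi0 | lra].
      * apply (Rmult_le_compat_r (c ^ 2)) in H; lra.
Qed.

Theorem theorem2 (gamma : R -> R * R) (p : R -> R) (lam0 c : R)
  (hgamma : centroaffine gamma) (hanti : anti_periodic gamma)
  (hp : centroaffine_curvature gamma p)
  (hlam0 : lowest_periodic_eigenvalue p lam0) (hneg : lam0 < 0) :
  (exists delta : R -> R * R,
      centroaffine delta /\ anti_periodic delta /\ c_related c gamma delta)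
  <-> Rabs c <= 1 / sqrt (- lam0).
Proof.
  destruct (Req_dec c 0) as [-> | Hc].
  { split; intros _.
    - rewrite Rabs_R0; apply Rlt_le, Rdiv_lt_0_compat; [lra | apply sqrt_lt_R0; lra].
    - exists gamma; split; [exact hgamma | split; [exact hanti|]].
      intros t; unfold det2; ring. }
  rewrite (Rabs_le_inv_sqrt c lam0 Hc hneg); split.
  - intros [delta [Hd [Ad Hcd]]].
    apply (riccati_solution_le_eigenvalue p
             (fun t => - / c * det2 (delta t) (velocity gamma t))).
    + now apply riccati_of_c_related.
    + apply hlam0.
  - intros Hle.
    destruct (riccati_solution_of_le_lowest_eigenvalue p (- / c ^ 2) lam0) as [w Hw].
    + now apply curvature_periodic_C1 with gamma.
    + exact hlam0.
    + exact Hle.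
    + now apply c_related_of_riccati with p w.
Qed.
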